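(* Let $m\in\mathbb N$, let $X,X_1,\dots,X_m,Y$ be operator spaces, let $T\colon X\to\bigoplus_{k=1}^mX_k$ be a completely bounded linear operator, and let $Q\colon\bigoplus_{k=1}^mX_k\to Y$ be a completely controlled $m$-linear map. Then $Q\circ T\colon B_X\to Y$ is completely Lipschitz in small scale.
   Context: Operator spaces are complex: an operator space is a closed linear subspace $X\subseteq \mathcal B(H)$, $H$ a complex Hilbert space, with $\mathrm M_n(X)$ normed through $\mathrm M_n(X)\subseteq \mathrm M_n(\mathcal B(H))\cong\mathcal B(H^{\oplus n})$. $B_E$ is the closed unit ball of $E$. For a map $f$, $f_n([x_{ij}])=[f(x_{ij})]$; a linear $u$ is completely bounded if $\|u\|_{\rm cb}=\sup_n\|u_n\|<\infty$. $\bigoplus_{k=1}^mX_k$ carries the $\ell_\infty$-sum operator space structure, so $\mathrm M_n(\bigoplus_kX_k)=\bigoplus_k\mathrm M_n(X_k)$ with the max norm. An $m$-linear map $Q\colon\bigoplus_{k=1}^mX_k\to Y$ is a map that is linear in each of the $m$ coordinates; $\|Q\|$ is the infimum of $L>0$ with $\|Q(x^{(1)},\dots,x^{(m)})\|\le L\|x^{(1)}\|\cdots\|x^{(m)}\|$ for all $x^{(k)}\in X_k$. Its $n$-amplification $Q_n\colon\bigoplus_k\mathrm M_n(X_k)\to\mathrm M_n(Y)$, $Q_n([x^{(1)}_{ij}],\dots,[x^{(m)}_{ij}])=[Q(x^{(1)}_{ij},\dots,x^{(m)}_{ij})]$, is also $m$-linear. $Q$ is completely controlled if $\|Q\|_{\rm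 cc}=\sup_n\|Q_n\|<\infty$. A map $f\colon B_X\to Y$ is completely Lipschitz in small scale if there is $L>0$ such that $\|f_n(x)-f_n(y)\|_{\mathrm M_n(Y)}\le L\|x-y\|_{\mathrm M_n(X)}$ for all $n\in\mathbb N$ and all $x,y\in B_{\mathrm M_n(X)}$. *)

(* Defs.v *)
From HB Require Import structures.
From mathcomp Require Import all_boot all_order all_algebra.
From mathcomp Require Import sesquilinear complex.
From mathcomp Require Import all_classical all_reals all_analysis.
Set Implicit Arguments.
Unset Strict Implicit.
Unset Printing Implicit Defensive.
Import Order.TTheory GRing.Theory Num.Theory.
Import numFieldNormedType.Exports.
Local Open Scope classical_set_scope.
Local Open Scope ring_scope.

(* The least constant L with q (f x) <= L * p x for all x; it is +oo when there
   is none. With p, q norms and f linear this is the operator norm. *)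
Definition bound_norm (R : realType) (E F : Type) (p : E -> R) (q : F -> R)
    (f : E -> F) : \bar R :=
  ereal_inf [set L%:E | L in [set L : R | 0 < L /\
                                forall x, q (f x) <= L * p x]].

(* Complex Hilbert spaces. The library norm of a normed module over R[i] takes
   its values in R[i]; [hnorm] is the same norm as an element of R. *)
Record hilbert (R : realType) := Hilbert {
  hilbert_sort :> completeNormedModType R[i];
  hdot : {dot hilbert_sort for @Num.conj R[i]};
  hdotE : forall h : hilbert_sort, `|h| ^+ 2 = hdot h h
}.

Definition hnorm (R : realType) (H : hilbert R) (h : H) : R :=
  complex.Re `|h|.

(* The norm of the Hilbert space direct sum of n copies of H. *)
Definition hnormn (R : realType) (H : hilbert R) n (h : 'I_n -> H) : R :=
  Num.sqrt (\sum_i hnorm (h i) ^+ 2).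

Definition opnorm (R : realType) (H : hilbert R) (f : H -> H) : \bar R :=
  bound_norm (@hnorm R H) (@hnorm R H) f.

(* B(H), as a subset of the vector space H -> H *)
Definition bounded_op (R : realType) (H : hilbert R) : set (H -> H) :=
  [set f | linear f /\ (opnorm f < +oo)%E].

(* A closed linear subspace [os_mem] of B([os_hilb]). *)
Record opspace (R : realType) := OpSpace {
  os_hilb : hilbert R;
  os_mem : {pred os_hilb -> os_hilb};
  os_sub : forall f, f \in os_mem -> bounded_op f;
  os_submod : submod_closed os_mem;
  os_closed : forall f : os_hilb -> os_hilb, bounded_op f ->
    (forall e : R, 0 < e -> exists2 g, g \in os_mem & (opnorm (f \- g)%R < e%:E)%E) ->
    f \in os_mem
}.

HB.instance Definition _ (R : realType) (X : opspace R) :=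
  GRing.isSubmodClosed.Build R[i] _ (@os_mem R X) (@os_submod R X).

(* The elements of X, with the linear structure of H -> H. *)
Record os_elt (R : realType) (X : opspace R) := OsElt {
  os_val : os_hilb X -> os_hilb X;
  os_valP : os_val \in @os_mem R X
}.

Section OsElt.
Variables (R : realType) (X : opspace R).
HB.instance Definition _ := [isSub for @os_val R X].
HB.instance Definition _ := [Choice of os_elt X by <:].
HB.instance Definition _ := [SubChoice_isSubLmodule of os_elt X by <:].
End OsElt.

Definition os_type (R : realType) (X : opspace R) : lmodType R[i] := os_elt X.
Coercion os_type : opspace >-> GRing.Lmodule.type.

Section MatrixNorm.
Variables (R : realType) (X : opspace R).

(* The action on n copies of H of a matrix of operators on H. *)
Definition mxact n (x : 'M[X]_n) (h : 'I_n -> os_hilb X) : 'I_n -> os_hilb X :=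
  fun i => \sum_j os_val (x i j) (h j).

(* The norm of M_n(X); the [bound_norm] is finite by [mxnorm_fin]. *)
Definition mxnorm n (x : 'M[X]_n) : R :=
  fine (bound_norm (@hnormn R (os_hilb X) n) (@hnormn R (os_hilb X) n)
          (mxact x)).

Definition osnorm (x : X) : R := fine (opnorm (os_val x)).

Record os_ball := OsBall {
  ball_val : X;
  ball_valP : osnorm ball_val <= 1
}.

End MatrixNorm.

Section MxnormEntry.
Variables (R : realType) (H : hilbert R).
Implicit Types h k : H.

Lemma hnorm_ge0 h : 0 <= hnorm h.
Proof. by have := normr_ge0 h; rewrite lecE => /andP[]. Qed.
Lemma hnorm0 : hnorm (0 : H) = 0.
Proof. by rewrite /hnorm normr0. Qed.
Lemma hnormD h k : hnorm (h + k) <= hnorm h + hnorm k.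
Proof.
have := ler_normD h k; rewrite lecE => /andP[_].
by rewrite raddfD.
Qed.
Lemma hnorm_sum (I : finType) (h : I -> H) : hnorm (\sum_i h i) <= \sum_i hnorm (h i).
Proof.
apply: (big_ind2 (fun (a : H) b => hnorm a <= b)) => [|a b c d ab cd|//].
  by rewrite hnorm0.
by rewrite (le_trans (hnormD _ _))// lerD.
Qed.
Lemma hnorm_le_hnormn n (h : 'I_n -> H) i : hnorm (h i) <= hnormn h.
Proof.
rewrite -(ger0_norm (hnorm_ge0 (h i))) -sqrtr_sqr ler_wsqrtr// (bigD1 i)//=.
by rewrite lerDl sumr_ge0// => j _; exact: sqr_ge0.
Qed.
Lemma hnormn_le_sum n (h : 'I_n -> H) : hnormn h <= \sum_i hnorm (h i).
Proof.
have s0 : 0 <= \sum_i hnorm (h i) by apply: sumr_ge0 => i _; exact: hnorm_ge0.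
rewrite -[leRHS](ger0_norm s0) -sqrtr_sqr ler_wsqrtr// [leRHS]expr2 mulr_suml.
apply: ler_sum => i _; rewrite expr2 ler_wpM2l ?hnorm_ge0// (bigD1 i)//=.
by rewrite lerDl sumr_ge0// => j _; exact: hnorm_ge0.
Qed.
Lemma hnormn_single n (h : H) (i : 'I_n) :
  hnormn (fun j => if j == i then h else 0) = hnorm h.
Proof.
rewrite /hnormn (bigD1 i)//= eqxx big1 ?addr0.
  by rewrite sqrtr_sqr ger0_norm// hnorm_ge0.
by move=> j /negPf->; rewrite hnorm0 expr0n.
Qed.
End MxnormEntry.

Section EntryNorm.
Variables (R : realType).
Lemma bound_norm_ge0 (E F : Type) (p : E -> R) (q : F -> R) f : (0 <= bound_norm p q f)%E.
Proof. by apply: le_ereal_inf_tmp => _ [L [L0 _] <-]; rewrite lee_fin ltW. Qed.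
Lemma bound_norm_ltoo (E F : Type) (p : E -> R) (q : F -> R) f :
  (bound_norm p q f < +oo)%E -> exists2 L, 0 < L & forall x, q (f x) <= L * p x.
Proof. by case/ereal_inf_lt => _ [L [L0 HL] <-] _; exists L. Qed.

Variable (X : opspace R).
Lemma mxnorm_fin n (x : 'M[X]_n) :
  (bound_norm (@hnormn R (os_hilb X) n) (@hnormn R (os_hilb X) n)
          (mxact x) < +oo)%E.
Proof.
have /choice[L HL] (ij : 'I_n * 'I_n) : exists L, 0 < L /\
    forall h, hnorm (os_val (x ij.1 ij.2) h) <= L * hnorm h.
  have [_ /bound_norm_ltoo[L L0 HL]] := os_sub (os_valP (x ij.1 ij.2)).
  by exists L.
have s0 : 0 <= \sum_i \sum_j L (i, j).
  by apply: sumr_ge0 => i _; apply: sumr_ge0 => j _; have [/ltW] := HL (i, j).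
apply: (@le_lt_trans _ _ (1 + \sum_i \sum_j L (i, j))%:E); last exact: ltry.
apply: ereal_inf_lbound; exists (1 + \sum_i \sum_j L (i, j)) => //; split.
  by rewrite ltr_pwDl.
move=> h; apply: (le_trans (hnormn_le_sum _)).
apply: (@le_trans _ _ ((\sum_i \sum_j L (i, j)) * hnormn h)); last first.
  by rewrite ler_wpM2r ?sqrtr_ge0// lerDr.
rewrite mulr_suml; apply: ler_sum => i _.
rewrite mulr_suml; apply: (le_trans (hnorm_sum _)); apply: ler_sum => j _.
have [L0 /(_ (h j))/le_trans] := HL (i, j); apply.
by rewrite ler_wpM2l ?(ltW L0)// hnorm_le_hnormn.
Qed.

Lemma osnorm_le_mxnorm n (x : 'M[X]_n) i j : osnorm (x i j) <= mxnorm x.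
Proof.
have [_ fin1] := os_sub (os_valP (x i j)).
rewrite /osnorm /mxnorm fine_le//.
- by rewrite ge0_fin_numE// bound_norm_ge0.
- by rewrite ge0_fin_numE ?mxnorm_fin// bound_norm_ge0.
apply: le_ereal_inf => _ [L [L0 HL] <-]; exists L => //; split => // h.
rewrite -(hnormn_single h j); apply: le_trans (HL _).
apply: le_trans (hnorm_le_hnormn _ i); rewrite /mxact (bigD1 j)//= eqxx big1 ?addr0//.
move=> k /negPf->; have [lin _] := os_sub (os_valP (x i k)).
by have := lin (-1) 0 0; rewrite scaler0 addr0 scaleN1r addNr.
Qed.
End EntryNorm.

Section DirectSum.
Variables (R : realType) (m : nat) (X_ : 'I_m -> opspace R).

Definition dsum : Type := forall k, X_ k.

HB.instance Definition _ := gen_eqMixin dsum.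
HB.instance Definition _ := gen_choiceMixin dsum.

Implicit Types x y z : dsum.
Let add x y : dsum := fun k => x k + y k.
Let opp x : dsum := fun k => - x k.
Let scale (a : R[i]) x : dsum := fun k => a *: x k.

Let addA : associative add.
Proof. by move=> x y z; apply/functional_extensionality_dep => k; exact: addrA. Qed.
Let addC : commutative add.
Proof. by move=> x y; apply/functional_extensionality_dep => k; exact: addrC. Qed.
Let add0 : left_id ((fun=> 0) : dsum) add.
Proof. by move=> x; apply/functional_extensionality_dep => k; exact: add0r. Qed.
Let addN : left_inverse ((fun=> 0) : dsum) opp add.
Proof. by move=> x; apply/functional_extensionality_dep => k; exact: addNr. Qed.
HB.instance Definition _ := GRing.isZmodule.Build dsum addA addC add0 addN.

Let scaleA a b x : scale a (scale b x) = scale (a * b) x.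
Proof. by apply/functional_extensionality_dep => k; exact: scalerA. Qed.
Let scale1 : left_id 1 scale.
Proof. by move=> x; apply/functional_extensionality_dep => k; exact: scale1r. Qed.
Let scaleDr : right_distributive scale +%R.
Proof. by move=> a x y; apply/functional_extensionality_dep => k; exact: scalerDr. Qed.
Let scaleDl x : {morph scale^~ x : a b / a + b}.
Proof. by move=> a b; apply/functional_extensionality_dep => k; exact: scalerDl. Qed.
HB.instance Definition _ :=
  GRing.Zmodule_isLmodule.Build R[i] dsum scaleA scale1 scaleDr scaleDl.

(* M_n of the direct sum is the direct sum of the M_n(X_ k), max norm. *)
Definition dsum_mxnorm n (x : 'M[dsum]_n) : R :=
  \big[Num.max/0]_(k < m) mxnorm (map_mx (fun z : dsum => z k) x).

End DirectSum.

(* For u : E -> F, the amplification u_n is [map_mx u : 'M[E]_n -> 'M[F]_n];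
   NE and NF are the norms of M_n(E) and M_n(F). *)
Definition cb_norm (R : realType) (E F : Type)
    (NE : forall n, 'M[E]_n -> R) (NF : forall n, 'M[F]_n -> R)
    (u : E -> F) : \bar R :=
  ereal_sup [set bound_norm (@NE n) (@NF n) (map_mx u) | n in [set n | (0 < n)%N]].

Definition completely_bounded (R : realType) (m : nat) (X : opspace R)
    (X_ : 'I_m -> opspace R) (T : {linear X -> dsum X_}) : Prop :=
  (cb_norm (@mxnorm R X) (@dsum_mxnorm R m X_) T < +oo)%E.

Section Multilinear.
Variables (R : realType) (m : nat) (X_ : 'I_m -> opspace R) (Y : opspace R).
Implicit Type Q : dsum X_ -> Y.

(* [dfwith x u] is x with its k-th coordinate replaced by u : X_ k. *)
Definition multilinear Q : Prop :=
  forall (k : 'I_m) (x : dsum X_), linear (fun u : X_ k => Q (eqtype.dfwith x u)).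

Definition mlin_amp n Q (x : forall k, 'M[X_ k]_n) : 'M[Y]_n :=
  \matrix_(i, j) Q (fun k => x k i j).

(* The norm of Q_n as an m-linear map. *)
Definition mlin_amp_norm n Q : \bar R :=
  bound_norm (fun x : forall k, 'M[X_ k]_n => \prod_k mxnorm (x k))
    (@mxnorm R Y n) (mlin_amp Q).

Definition cc_norm Q : \bar R :=
  ereal_sup [set mlin_amp_norm n Q | n in [set n | (0 < n)%N]].

Definition completely_controlled Q : Prop := (cc_norm Q < +oo)%E.

End Multilinear.

(* By [osnorm_le_mxnorm], a matrix in the unit ball of M_n(X) has its entries in
   B_X, so that it is [map_mx ball_val] of a matrix over [os_ball X], to which
   f_n = [map_mx f] applies. *)
Definition completely_lipschitz_small_scale (R : realType) (X Y : opspace R)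
    (f : os_ball X -> Y) : Prop :=
  exists2 L : R, 0 < L & forall (n : nat) (x y : 'M[os_ball X]_n),
    let x' := map_mx (@ball_val R X) x in
    let y' := map_mx (@ball_val R X) y in
    (0 < n)%N -> mxnorm x' <= 1 -> mxnorm y' <= 1 ->
    mxnorm (map_mx f x - map_mx f y) <= L * mxnorm (x' - y').

(* Main.v *)
Require Import Defs.
From mathcomp Require Import all_boot all_order all_algebra.
From mathcomp Require Import ring lra.
From mathcomp Require Import complex.
From mathcomp Require Import all_classical all_reals all_analysis.
Set Implicit Arguments.
Unset Strict Implicit.
Unset Printing Implicit Defensive.
Import Order.TTheory GRing.Theory Num.Theory.
Local Open Scope ring_scope.

(** A multilinear map is Lipschitz on bounded sets because a difference of its
    values telescopes: replacing the coordinates of [x] by those of [y] one at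
    a time,
      Q_n x - Q_n y =
        \sum_k Q_n (y_1, .., y_(k-1), x_k - y_k, x_(k+1), .., x_m).
    The amplification [mlin_amp Q] is again multilinear, so the same identity
    holds at each matrix level, and complete control bounds every summand by
    [C] times the product of the norms of the arguments, with [C] independent
    of [n] ([mxnorm_mlin_ampB]).

    For [x] and [y] in the unit ball of M_n(X) the coordinates of [T_n x] and
    [T_n y] have norm at most [r], and those of [T_n (x - y)] have norm at most
    [r * mxnorm (x - y)], where [r] bounds all the amplifications of [T]. Hence
    [m * C * r ^+ m] is a Lipschitz constant valid for every [n].

    Summing the telescope requires the triangle inequality for [mxnorm], that
    is for operators on the Hilbert sum of [n] copies of H ([mxnormD]). *)

Section BoundNorm.
Variable R : realType.

(** The strict inequality lets some admissible constant lie below [C], so the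
    infimum defining [bound_norm] does not have to be attained. *)
Lemma bound_norm_lt (E F : Type) (p : E -> R) (q : F -> R) (f : E -> F) (C : R) :
  (forall x, 0 <= p x) -> (bound_norm p q f < C%:E)%E ->
  forall x, q (f x) <= C * p x.
Proof.
move=> p0 /ereal_inf_lt[_ [L [_ qL] <-]]; rewrite lte_fin => LC x.
by rewrite (le_trans (qL x))// ler_wpM2r// ltW.
Qed.

Lemma ereal_sup_ltoo_bound (A : set (\bar R)) :
  (ereal_sup A < +oo)%E -> exists2 C : R, 0 < C & forall a, A a -> (a < C%:E)%E.
Proof.
move=> Aoo; exists (Num.max 1 (fine (ereal_sup A) + 1)).
  by rewrite lt_max ltr01.
move=> a /ereal_sup_ubound aA; apply: (le_lt_trans aA).
case: (ereal_sup A) Aoo => [s _|//|_] /=; last exact: ltNyr.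
by rewrite lte_fin lt_max ltrDl ltr01 orbT.
Qed.

End BoundNorm.

Section MatrixNormTheory.
Context {R : realType} {X : opspace R} {n : nat}.
Implicit Types x y : 'M[X]_n.

Let bounds x (L : R) := forall h, hnormn (mxact x h) <= L * hnormn h.

Lemma mxnorm_ge0 x : 0 <= mxnorm x.
Proof. exact/fine_ge0/bound_norm_ge0. Qed.

Lemma mxnormE x :
  (mxnorm x)%:E = bound_norm (@hnormn R (os_hilb X) n)
                    (@hnormn R (os_hilb X) n) (mxact x).
Proof. by rewrite fineK// ge0_fin_numE ?mxnorm_fin// bound_norm_ge0. Qed.

Lemma mxnorm_le x (L : R) : 0 < L -> bounds x L -> mxnorm x <= L.
Proof.
by move=> L0 xL; rewrite -lee_fin mxnormE; apply: ereal_inf_lbound; exists L.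
Qed.

Lemma mxnorm_approx x (e : R) : 0 < e ->
  exists L : R, [/\ 0 < L, L < mxnorm x + e & bounds x L].
Proof.
move=> e0; have : ((mxnorm x)%:E < (mxnorm x + e)%:E)%E by rewrite lte_fin ltrDl.
rewrite {1}mxnormE => /ereal_inf_lt[_ [L [L0 xL] <-]].
by rewrite lte_fin => Le; exists L.
Qed.

Lemma hnormn_le (H : hilbert R) (h : 'I_n -> H) (c : R) : 0 <= c ->
  (hnormn h <= c) = (\sum_i hnorm (h i) ^+ 2 <= c ^+ 2).
Proof.
move=> c0; rewrite -(@ler_pXn2r _ 2)// ?nnegrE ?sqrtr_ge0//.
by rewrite sqr_sqrtr// sumr_ge0// => i _; exact: sqr_ge0.
Qed.

Lemma mxactD x y h i : mxact (x + y) h i = mxact x h i + mxact y h i.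
Proof. by rewrite -big_split; apply: eq_bigr => j _; rewrite mxE. Qed.

(** The triangle inequality is proved for the constants of [bound_norm] rather
    than for [mxnorm] because these are positive: its proof divides by them. *)
Lemma boundsD x y (L M : R) : 0 < L -> 0 < M ->
  bounds x L -> bounds y M -> bounds (x + y) (L + M).
Proof.
move=> L0 M0 xL yM h.
have h0 : 0 <= hnormn h by exact: sqrtr_ge0.
have := xL h; rewrite hnormn_le ?mulr_ge0 ?(ltW L0)// => {}xL.
have := yM h; rewrite hnormn_le ?mulr_ge0 ?(ltW M0)// => {}yM.
have LM0 : 0 <= (L + M) * hnormn h by rewrite mulr_ge0// ltW// addr_gt0.
rewrite hnormn_le//.
(* Minkowski's inequality for two vectors of known bounds L and M: weighting
   Young's inequality 2ab <= t a^2 + t^-1 b^2 by t = M / L is optimal. *)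
have young (a b : R) : (a + b) ^+ 2 <= (1 + M / L) * a ^+ 2 + (1 + L / M) * b ^+ 2.
  rewrite -subr_ge0.
  suff -> : (1 + M / L) * a ^+ 2 + (1 + L / M) * b ^+ 2 - (a + b) ^+ 2 =
            (M * a - L * b) ^+ 2 / (L * M).
    by rewrite divr_ge0 ?sqr_ge0// mulr_ge0 ?ltW.
  by field; rewrite !gt_eqF.
apply: (@le_trans _ _ ((1 + M / L) * \sum_i hnorm (mxact x h i) ^+ 2 +
                       (1 + L / M) * \sum_i hnorm (mxact y h i) ^+ 2)).
  rewrite !mulr_sumr -big_split; apply: ler_sum => i _; apply: le_trans (young _ _).
  apply: lerXn2r; rewrite ?nnegrE ?addr_ge0 ?hnorm_ge0// mxactD.
  exact: Defs.hnormD.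
have -> : ((L + M) * hnormn h) ^+ 2 =
    (1 + M / L) * (L * hnormn h) ^+ 2 + (1 + L / M) * (M * hnormn h) ^+ 2.
  by field; rewrite !gt_eqF.
by rewrite lerD// ler_wpM2l// addr_ge0// divr_ge0// ltW.
Qed.

Lemma mxnormD x y : mxnorm (x + y) <= mxnorm x + mxnorm y.
Proof.
apply/ler_addgt0Pr => e e0; have e20 : 0 < e / 2 by rewrite divr_gt0.
have [L [L0 Lx xL]] := mxnorm_approx x e20.
have [M [M0 My yM]] := mxnorm_approx y e20.
apply: (le_trans (mxnorm_le (addr_gt0 L0 M0) (boundsD L0 M0 xL yM))).
by lra.
Qed.

Lemma mxnorm0 : mxnorm (0 : 'M[X]_n) = 0.
Proof.
apply/eqP; rewrite eq_le mxnorm_ge0 andbT; apply/ler_addgt0Pr => e e0.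
rewrite add0r; apply: mxnorm_le => // h.
have -> : mxact 0 h = fun=> 0.
  by apply/funext => i; rewrite /mxact big1// => j _; rewrite mxE.
rewrite /hnormn big1 ?sqrtr0 ?mulr_ge0 ?sqrtr_ge0 ?(ltW e0)// => i _.
by rewrite hnorm0 expr0n.
Qed.

Lemma mxnorm_sum (I : finType) (F : I -> 'M[X]_n) :
  mxnorm (\sum_i F i) <= \sum_i mxnorm (F i).
Proof.
apply: (big_ind2 (fun x (c : R) => mxnorm x <= c)) => [|x a y b xa yb|//].
  by rewrite mxnorm0.
by rewrite (le_trans (mxnormD _ _))// lerD.
Qed.

End MatrixNormTheory.

Section Telescope.
Context {R : realType} {m : nat} {X_ : 'I_m -> opspace R} {Y : opspace R}.
Variables (Q : dsum X_ -> Y) (Q_ml : multilinear Q) (n : nat).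
Implicit Types x y z : forall k, 'M[X_ k]_n.

Lemma mlin_amp_dfwithB z k (u v : 'M[X_ k]_n) :
  mlin_amp Q (eqtype.dfwith z (u - v)) =
  mlin_amp Q (eqtype.dfwith z u) - mlin_amp Q (eqtype.dfwith z v).
Proof.
apply/matrixP => i j; rewrite !mxE.
have entry (w : 'M[X_ k]_n) : (fun l => eqtype.dfwith z w l i j) =
    eqtype.dfwith (fun l => z l i j : X_ l) (w i j).
  apply/functional_extensionality_dep => l.
  have [<-|kl] := eqVneq k l; first by rewrite !dfwith_in.
  by rewrite !dfwith_out.
rewrite !entry !mxE.
have /= := Q_ml (fun l => z l i j : X_ l) (-1) (v i j) (u i j).
by rewrite !scaleN1r [RHS]addrC [in LHS]addrC.
Qed.

Definition hybrid x y (i : nat) : forall k, 'M[X_ k]_n :=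
  fun k => if (k < i)%N then y k else x k.

Lemma mlin_ampB x y :
  mlin_amp Q x - mlin_amp Q y =
  \sum_(k < m) mlin_amp Q (eqtype.dfwith (hybrid x y k) (x k - y k)).
Proof.
have E0 : hybrid x y 0 = x by [].
have Em : hybrid x y m = y.
  by apply/functional_extensionality_dep => k; rewrite /hybrid ltn_ord.
have := telescope_sumr (fun i => mlin_amp Q (hybrid x y i)) (leq0n m).
rewrite E0 Em big_mkord => tele; rewrite -opprB -tele -sumrN.
apply: eq_bigr => k _; rewrite opprB mlin_amp_dfwithB; congr (_ - _);
  congr mlin_amp; apply/functional_extensionality_dep => l.
(* The [k]-th coordinate is the only one in which the two hybrids differ. *)
- have [<-|kl] := eqVneq k l; last by rewrite dfwith_out.
  by rewrite dfwith_in /hybrid ltnn.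
- have [<-|kl] := eqVneq k l; first by rewrite dfwith_in /hybrid ltnS leqnn.
  rewrite dfwith_out// /hybrid ltnS leq_eqVlt.
  by rewrite (negPf (_ : l != k :> nat)) // eq_sym.
Qed.

(** The factor [d] appears once in each telescope summand: one coordinate is a
    difference, of norm at most [r * d], and the other [m - 1] have norm at
    most [r]. *)
Lemma mxnorm_mlin_ampB (C r d : R) x y :
  0 <= C ->
  (forall z, mxnorm (mlin_amp Q z) <= C * \prod_k mxnorm (z k)) ->
  (forall k, mxnorm (x k) <= r) -> (forall k, mxnorm (y k) <= r) ->
  (forall k, mxnorm (x k - y k) <= r * d) ->
  mxnorm (mlin_amp Q x - mlin_amp Q y) <= m%:R * C * r ^+ m * d.
Proof.
move=> C0 QC xr yr xyd; rewrite mlin_ampB; apply: (le_trans (mxnorm_sum _)).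
have -> : m%:R * C * r ^+ m * d = \sum_(k < m) (C * (r ^+ m * d)).
  by rewrite sumr_const card_ord -!mulrA mulr_natl.
apply: ler_sum => k _; apply: (le_trans (QC _)); rewrite ler_wpM2l//.
have -> : r ^+ m * d = \prod_(l < m) (r * (if l == k then d else 1)).
  rewrite big_split /= prodr_const card_ord; congr (_ * _).
  by rewrite (bigD1 k)//= eqxx big1 ?mulr1// => l /negPf->.
apply: ler_prod => l _; rewrite mxnorm_ge0 /=.
have [->|lk] := eqVneq l k; first by rewrite dfwith_in.
by rewrite dfwith_out 1?eq_sym// mulr1 /hybrid; case: ifP.
Qed.

End Telescope.

Lemma completely_controlled_bound (R : realType) (m : nat)
    (X_ : 'I_m -> opspace R) (Y : opspace R) (Q : dsum X_ -> Y) :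
  completely_controlled Q ->
  exists2 C : R, 0 < C & forall n (z : forall k, 'M[X_ k]_n), (0 < n)%N ->
    mxnorm (mlin_amp Q z) <= C * \prod_k mxnorm (z k).
Proof.
move=> /ereal_sup_ltoo_bound[C C0 QC]; exists C => // n z n0.
apply: (bound_norm_lt (p := fun w : forall k, 'M[X_ k]_n => \prod_k mxnorm (w k))).
  by move=> w; apply: prodr_ge0 => k _; exact: mxnorm_ge0.
by apply: QC; exists n.
Qed.

Lemma completely_bounded_bound (R : realType) (m : nat) (X : opspace R)
    (X_ : 'I_m -> opspace R) (T : {linear X -> dsum X_}) :
  completely_bounded T ->
  exists2 r : R, 0 < r & forall n (x : 'M[X]_n) k, (0 < n)%N ->
    mxnorm (map_mx (fun a => T a k) x) <= r * mxnorm x.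
Proof.
move=> /ereal_sup_ltoo_bound[r r0 Tr]; exists r => // n x k n0.
apply: le_trans (bound_norm_lt (C := r) (f := map_mx T) (@mxnorm_ge0 _ _ n)
  (Tr _ _) x); last by exists n.
have -> : map_mx (fun a => T a k) x = map_mx (fun z : dsum X_ => z k) (map_mx T x).
  by apply/matrixP => i j; rewrite !mxE.
exact: (le_bigmax _ (fun l => mxnorm (map_mx (fun z : dsum X_ => z l) _)) k).
Qed.

Unset Implicit Arguments.

Theorem theorem3p3 (R : realType) (m : nat) (m_gt0 : (0 < m)%N)
    (X : opspace R) (X_ : 'I_m -> opspace R) (Y : opspace R)
    (T : {linear X -> dsum X_}) (Q : dsum X_ -> Y)
    (T_cb : completely_bounded T)
    (Q_ml : multilinear Q) (Q_cc : completely_controlled Q) :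
  completely_lipschitz_small_scale (fun x : os_ball X => Q (T (ball_val x))).
Proof.
have [C C0 QC] := completely_controlled_bound Q_cc.
have [r r0 Tr] := completely_bounded_bound T_cb.
exists (m%:R * C * r ^+ m); first by rewrite !mulr_gt0 ?ltr0n ?exprn_gt0.
move=> n x y x' y' n0 x1 y1.
pose coords (w : 'M[X]_n) k := map_mx (fun a => T a k) w.
have amp (w : 'M[os_ball X]_n) : map_mx (fun a => Q (T (ball_val a))) w =
    mlin_amp Q (coords (map_mx (@ball_val R X) w)).
  apply/matrixP => i j; rewrite !mxE; congr Q.
  by apply/functional_extensionality_dep => k; rewrite !mxE.
have ball (w : 'M[X]_n) k : mxnorm w <= 1 -> mxnorm (coords w k) <= r.
  by move=> w1; rewrite (le_trans (Tr n w k n0))// ler_piMr// ltW.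
rewrite !amp; apply: mxnorm_mlin_ampB => //; first exact: ltW.
- by move=> z; exact: QC.
- by move=> k; exact: ball.
- by move=> k; exact: ball.
move=> k; have -> : coords x' k - coords y' k = coords (x' - y') k.
  by apply/matrixP => i j; rewrite !mxE raddfB.
exact: Tr.
Qed.
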